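(* Let a data distribution $p(X,\tau)$ with any label distribution $p(Y)$ be given, and let $b=\min_{\tau\in\mathcal{T}}p(\tau)$. For any classifier $h$ and any knowledge base $B$, if the abduced labels $\bar Y$ are randomly selected from $\mathcal{S}(\tau)$ and $\ell$ is the cross-entropy loss, then $$\mathcal{R}_{\mathrm{TL}}(h)\le\mathcal{R}_{\mathrm{NeSy}}(h)+C,$$ where $C=\log m-\log b$ is a constant.
   Context: Notation: $[n]=\{0,1,\dots,n-1\}$. $\mathcal{X}\subseteq\mathbb{R}^d$ is the input space, $\mathcal{Y}=[c]$ the label space with $c$ classes, $m$ the length of input sequences, and $\mathcal{T}$ the (finite) space of target concepts, indexed by $\{0,\dots,|\mathcal{T}|-1\}$. $B$ is a knowledge base consisting of first-order logic rules, $\models$ denotes logical entailment, and for a target concept $\tau\in\mathcal{T}$ the candidate set is $\mathcal{S}(\tau)=\{\bar Y\in\mathcal{Y}^m\mid B\cup\bar Y\models\tau\}$. Data: $p(X,\tau)$ is the underlying distribution of the input sequence $X=[x_0,\dots,x_{m-1}]\in\mathcal{X}^m$ and the target concept $\tau\in\mathcal{T}$, with marginal $p(\tau)$. The ground-truth labels $Y=[y_0,\dots,y_{m-1}]\in\mathcal{Y}^m$ of $X$ have distribution $p(Y)$, are not observed, and satisfy $B\cup Y\models\tau$. Classifier: a map $h:\mathcal{X}\to\mathbb{R}^c$. Put $g_j(x)=\exp(h_j(x))/\sum_{i=0}^{c-1}\exp(h_i(x))$ for $j\in[c]$. Cross-entropy loss: applied to $h$, $\ell(h(x),y)=-\log g_y(x)$;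 applied to a vector $\widetilde q(x)$ already interpreted as probabilities, $\ell(\widetilde q(x),o)=-\log\widetilde q_o(x)$. Inconsistency objective: $\mathcal{R}_{\mathrm{NeSy}}(h)=\mathbb{E}_{p(X,\tau)}\left[\frac1m\sum_{k=0}^{m-1}\ell(h(x_k),\bar y_k)\right]$, where $\bar Y=[\bar y_0,\dots,\bar y_{m-1}]$ denotes the abduced labels, which satisfy $B\cup\bar Y\models\tau$, i.e. $\bar Y\in\mathcal{S}(\tau)$; when $\bar Y$ is selected at random, the expectation also covers this random selection. Target-location-based risk (TL-Risk): each pair $\langle X,\tau\rangle$ yields the $m$ instance-location-target triplets $\langle x_\iota,\iota,\tau\rangle$, $\iota\in[m]$, where $\iota$ is the location of the instance $x_\iota$ in the sequence (so locations are uniform, $p(\iota=k)=1/m$). Let $\widetilde c=m\cdot|\mathcal{T}|$, and encode $(\iota,\tau)=(k,t)$ as the synthetic label $\widetilde y=o=tm+k\in[\widetilde c]$; $p(x,\widetilde y)$ is the resulting distribution of an instance and its synthetic label. Let $\widetilde Q\in\mathbb{R}^{c\times\widetilde c}$ with $\widetilde Q_{jo}=p(\widetilde y=o\mid y=j)=p(\iota=k,\tau=t\mid y=j)$ for $o=tm+k$, i.e. the probability of class $j$ occurring at the $k$-th position in a sequence of concept $t$, where $y$ is the true label of the instance. Set $\widetilde q(x)=\widetilde Q^\top g(x)$ and $$\mathcal{R}_{\mathrm{TL}}(h)=\mathbb{E}_{p(x,\widetilde y)}\,\ell(\widetilde q(x),\widetilde y).$$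
   Formalization: ''Randomly selected from S(τ)'' is taken as selection with probability p(Y=Ȳ | τ), which is uniform only if Y given τ is uniform on S(τ); with uniform selection and an arbitrary label distribution p(Y) the inequality can fail. *)

(* Defs.v *)
From HB Require Import structures.
From mathcomp Require Import all_boot all_order all_algebra.
From mathcomp Require Import all_classical all_reals all_analysis.

Set Implicit Arguments.
Unset Strict Implicit.
Unset Printing Implicit Defensive.

Import Order.TTheory GRing.Theory Num.Theory.
Local Open Scope classical_set_scope.
Local Open Scope ring_scope.

Record signature := Signature {
  fsym : Type;
  farity : fsym -> nat;
  rsym : Type;
  rarity : rsym -> nat }.

Inductive term (L : signature) : Type :=
  | TVar of nat
  | TApp (f : fsym L) of ('I_(farity f) -> term L).

Inductive formula (L : signature) : Type :=
  | FRel (r : rsym L) of ('I_(rarity r) -> term L)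
  | FEq of term L & term L
  | FFalse
  | FNot of formula L
  | FAnd of formula L & formula L
  | FOr of formula L & formula L
  | FImp of formula L & formula L
  | FAll of nat & formula L
  | FEx of nat & formula L.

Record interpretation (L : signature) := Interpretation {
  domain : Type;
  witness : domain;
  finterp : forall f : fsym L, ('I_(farity f) -> domain) -> domain;
  rinterp : forall r : rsym L, ('I_(rarity r) -> domain) -> Prop }.

Fixpoint teval L (M : interpretation L) (e : nat -> domain M) (t : term L)
    : domain M :=
  match t with
  | TVar x => e x
  | TApp f ts => finterp (fun i => teval e (ts i))
  end.

Definition update (D : Type) (e : nat -> D) (x : nat) (a : D) : nat -> D :=
  fun y => if y == x then a else e y.

Fixpoint sat L (M : interpretation L) (e : nat -> domain M) (phi : formula L)
    : Prop :=
  match phi with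
  | FRel r ts => rinterp (fun i => teval e (ts i))
  | FEq s t => teval e s = teval e t
  | FFalse => False
  | FNot a => ~ sat e a
  | FAnd a b => sat e a /\ sat e b
  | FOr a b => sat e a \/ sat e b
  | FImp a b => sat e a -> sat e b
  | FAll x a => forall v, sat (update e x v) a
  | FEx x a => exists v, sat (update e x v) a
  end.

(* Free variables, as in rules, are read as universally quantified. *)
Definition models L (M : interpretation L) (phi : formula L) : Prop :=
  forall e : nat -> domain M, sat e phi.

Definition entails L (Gamma : set (formula L)) (phi : formula L) : Prop :=
  forall M : interpretation L,
    (forall psi, Gamma psi -> models M psi) -> models M phi.

(* [fact k j] is the formula stating that the k-th instance has label j;
   [target t] is the formula of the concept of index t. *)
Definition candidates L (m c n : nat) (B : set (formula L))
    (fact : 'I_m -> 'I_c -> formula L) (target : 'I_n -> formula L)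
    (t : 'I_n) : {set m.-tuple 'I_c} :=
  [set Y : m.-tuple 'I_c |
    `[< entails (B `|` range (fun k => fact k (tnth Y k))) (target t) >]]%SET.

(* Measurable types are pointed in the library, so the index types of classes,
   concepts and locations are taken of the form 'I_k.+1, with the discrete
   sigma-algebra. *)
HB.instance Definition _ (k : nat) := isPointed.Build 'I_k.+1 ord0.
HB.instance Definition _ (k : nat) := @isMeasurable.Build
  default_measure_display 'I_k.+1 discrete_measurable discrete_measurable0
  discrete_measurableC discrete_measurableU.

(* A draw (X, Y, tau): the m.+1 inputs in R^d, their true labels among c.+1
   classes, and one of the n.+1 target concepts. *)
Notation sample R d m c n :=
  (m.+1.-tuple (d.-tuple R) * m.+1.-tuple 'I_c.+1 * 'I_n.+1)%type.

Section data.
Context {R : realType} {d m c n : nat}.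
Variable P : probability (sample R d m c n) R.

Definition inputs (s : sample R d m c n) : m.+1.-tuple (d.-tuple R) := s.1.1.
Definition labels (s : sample R d m c n) : m.+1.-tuple 'I_c.+1 := s.1.2.
Definition concept (s : sample R d m c n) : 'I_n.+1 := s.2.

Definition data_law : set (m.+1.-tuple (d.-tuple R) * 'I_n.+1) -> \bar R :=
  pushforward P (fun s => (inputs s, concept s)).

Definition concept_prob (t : 'I_n.+1) : \bar R := P (concept @^-1` [set t]).

(* The library's [lne] sends 0 to -oo, so -log b is +oo if some concept has
   probability 0. *)
Definition min_concept_prob : \bar R :=
  \big[Order.min/+oo%E]_(t < n.+1) concept_prob t.

(* Law of the random selection of abduced labels for the concept t: labellings
   follow the label distribution, i.e. p(Y = Yb | tau = t).  When Y is uniform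
   on the candidates of t given tau = t, this is uniform selection among the
   candidates. *)
Definition abduction_law (t : 'I_n.+1) (Yb : m.+1.-tuple 'I_c.+1) : R :=
  fine (P (labels @^-1` [set Yb] `&` concept @^-1` [set t]))
  / fine (concept_prob t).

(* Joint law of a sample and of a location that is uniform on 'I_m.+1 and
   independent of the sample. *)
Definition located_law (A : set (sample R d m c n * 'I_m.+1)) : \bar R :=
  ((m.+1%:R^-1)%:E * \sum_(k < m.+1) P [set s | A (s, k)])%E.

Section located_law_measure.
Local Open Scope ereal_scope.

Let mslice (A : set (sample R d m c n * 'I_m.+1)) (k : 'I_m.+1) :
  measurable A -> measurable [set s | A (s, k)].
Proof.
move=> mA; have mf : measurable_fun [set: sample R d m c n]
    (fun s => (s, k)) by exact: measurable_fun_pair.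
by rewrite -[X in measurable X]setTI; exact: mf.
Qed.

Let located_law0 : located_law set0 = 0.
Proof.
by rewrite /located_law big1 ?mule0// => k _; exact: measure0.
Qed.

Let located_law_ge0 A : 0 <= located_law A.
Proof. by apply: mule_ge0; [rewrite lee_fin | exact: sume_ge0]. Qed.

Let located_law_sigma_additive : semi_sigma_additive located_law.
Proof.
move=> F mF tF mUF; rewrite [X in X @ \oo --> _](_ : _ =
    (fun i => (m.+1%:R^-1)%:E *
      \sum_(0 <= j < i) \sum_(k < m.+1) P [set s | F j (s, k)])); last first.
  by apply/funext => i; rewrite ge0_sume_distrr// => j _; exact: sume_ge0.
apply: cvgeZl => //.
rewrite [X in _ --> X](_ : _ =
    lim ((fun i => \sum_(0 <= j < i) \sum_(k < m.+1) P [set s | F j (s, k)])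
      @ \oo)).
  by apply: is_cvg_ereal_nneg_natsum => k _; exact: sume_ge0.
rewrite nneseries_sum//; apply: eq_bigr => /= k _.
rewrite (_ : [set s | _] = \bigcup_i [set s | F i (s, k)]); last first.
  by apply/seteqP; split.
apply: measure_semi_bigcup => [i||].
- exact: mslice.
- by apply/trivIsetP => i j _ _ ij; apply/seteqP; split=> // s /= [Fi Fj];
    rewrite -[False]/(set0 (s, k));
    move/trivIsetP : tF => /(_ i j I I ij) <-.
- by rewrite (_ : \bigcup_i _ = [set s | (\bigcup_i F i) (s, k)]);
    [exact: mslice|apply/seteqP; split].
Qed.

HB.instance Definition _ := isMeasure.Build _ _ _ located_law
  located_law0 located_law_ge0 located_law_sigma_additive.

End located_law_measure.

End data.

Definition softmax {R : realType} {c : nat} (u : 'cV[R]_c) : 'cV[R]_c :=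
  \col_j (expR (u j 0) / \sum_i expR (u i 0)).

(* Cross-entropy of a vector of probabilities; it is +oo at probability 0. *)
Definition cross_entropy {R : realType} {c : nat} (q : 'cV[R]_c) (y : 'I_c) :
  \bar R := (- lne (q y 0)%:E)%E.

Section triplet.
Context {R : realType} {d m c n : nat}.
Implicit Types z : sample R d m c n * 'I_m.+1.

Lemma synthetic_subproof (k : 'I_m.+1) (t : 'I_n.+1) :
  (t * m.+1 + k < m.+1 * n.+1)%N.
Proof.
by rewrite [ltnRHS]mulnC (leq_trans (_ : _ < t.+1 * m.+1)%N)//;
  [rewrite mulSn addnC ltn_add2r | rewrite leq_mul2r ltn_ord].
Qed.

Definition synthetic (k : 'I_m.+1) (t : 'I_n.+1) : 'I_(m.+1 * n.+1) :=
  Ordinal (synthetic_subproof k t).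

Definition tinput z : d.-tuple R := tnth (inputs z.1) z.2.
Definition tlabel z : 'I_c.+1 := tnth (labels z.1) z.2.
Definition tsynth z : 'I_(m.+1 * n.+1) := synthetic z.2 (concept z.1).

End triplet.

Section risks.
Context {R : realType} {d m c n : nat}.
Variables (P : probability (sample R d m c n) R) (X : set (d.-tuple R)).
Variable h : d.-tuple R -> 'cV[R]_c.+1.

Definition triplet_law : set (d.-tuple R * 'I_(m.+1 * n.+1)) -> \bar R :=
  pushforward (located_law P) (fun z => (tinput z, tsynth z)).

(* Entry (j, o) is p(synthetic label = o | y = j).  Row j is 0 when
   p(y = j) = 0, where the conditional is undefined; any nonnegative value
   there would only lower the risk [tl_risk]. *)
Definition Qtilde : 'M[R]_(c.+1, m.+1 * n.+1) :=
  \matrix_(j, o)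
    (fine (located_law P (tsynth @^-1` [set o] `&` tlabel @^-1` [set j]))
     / fine (located_law P (tlabel @^-1` [set j]))).

Definition qtilde (x : d.-tuple R) : 'cV[R]_(m.+1 * n.+1) :=
  Qtilde^T *m softmax (h x).

Definition tl_risk : \bar R :=
  (\int[triplet_law]_(z in X `*` [set: 'I_(m.+1 * n.+1)])
     cross_entropy (qtilde z.1) z.2)%E.

(* [S] is the candidate set and [sel t] the law of the abduced labels given
   tau = t, which are independent of the inputs given tau. *)
Definition nesy_risk (S : 'I_n.+1 -> {set m.+1.-tuple 'I_c.+1})
    (sel : 'I_n.+1 -> m.+1.-tuple 'I_c.+1 -> R) : \bar R :=
  (\int[data_law P]_(z in [set z | forall k, X (tnth z.1 k)])
     \sum_(Yb in S z.2) (sel z.2 Yb)%:E *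
       ((m.+1%:R^-1)%:E *
        \sum_(k < m.+1) cross_entropy (softmax (h (tnth z.1 k))) (tnth Yb k)))%E.

End risks.

(* Main.v *)
(* The label distribution given tau = t selects Yb with probability
   p(Y = Yb | tau = t), so that
     Qtilde_(j, (k, t)) = p(y_k = j, tau = t) / (m p(y = j))
                       >= (p(t) / m) * sum_(Yb | Yb_k = j) p(Y = Yb | tau = t)
   because p(y = j) <= 1.  Hence the entry of qtilde(x) at (k, t) is at least
   b / m times the mean of g_(Yb_k)(x) under the selection law, and Jensen's
   inequality for -log bounds the TL-loss at (k, t) by log m - log b plus the
   expected loss of the abduced label.  Averaging over the location and
   integrating over the sample gives the claim; when b = 0 the bound is +oo. *)
Require Import Defs.
From mathcomp Require Import all_boot all_order all_algebra.
From mathcomp Require Import all_classical all_reals all_analysis.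
From mathcomp Require Import measurable_realfun.

Set Implicit Arguments.
Unset Strict Implicit.
Unset Printing Implicit Defensive.

Import Order.TTheory GRing.Theory Num.Theory.
Local Open Scope classical_set_scope.
Local Open Scope ring_scope.

(** * Jensen's inequality for the logarithm with finitely many weights *)

(** If the sum were 0, each nonnegative term and then each weight would vanish, against total weight
    1. It keeps the means below inside the domain of [ln]. *)
Lemma weighted_sum_gt0 {R : realType} (I : finType) (w x : I -> R) :
  (forall i, 0 <= w i) -> \sum_i w i = 1 -> (forall i, 0 < x i) ->
  0 < \sum_i w i * x i.
Proof.
move=> w0 w1 x0; have wx0 i : 0 <= w i * x i by rewrite mulr_ge0// ltW.
rewrite lt_def sumr_ge0// andbT; apply/eqP => /psumr_eq0P wx.
suff : \sum_i w i = 0 by apply/eqP; rewrite w1 oner_eq0.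
apply: big1 => i _; apply/eqP; move/eqP: (wx (fun i _ => wx0 i) i isT).
by rewrite mulf_eq0 (gt_eqF (x0 i)) orbF.
Qed.

(* Jensen's inequality for ln, from ln y <= y - 1 at y = x i / G, with G the
   weighted mean. *)
Lemma sum_mul_ln_le {R : realType} (I : finType) (w x : I -> R) :
  (forall i, 0 <= w i) -> \sum_i w i = 1 -> (forall i, 0 < x i) ->
  \sum_i w i * ln (x i) <= ln (\sum_i w i * x i).
Proof.
move=> w0 w1 x0; have := weighted_sum_gt0 w0 w1 x0.
set G := \sum_i w i * x i => G0.
rewrite -subr_le0 -[X in _ - X]mul1r -w1 mulr_suml -sumrB.
rewrite (@le_trans _ _ (\sum_i (w i * x i / G - w i)))//; last first.
  by rewrite sumrB -mulr_suml w1 divff ?gt_eqF// subrr.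
apply: ler_sum => i _; rewrite -mulrBr -mulrA -[X in _ <= _ - X]mulr1 -mulrBr.
rewrite ler_wpM2l// -ln_div ?posrE// -[X in ln X](subrKC 1).
by rewrite le_ln1Dx// ltrBrDr addNr divr_gt0.
Qed.

(** * Softmax and cross-entropy: bounds and measurability *)

Lemma softmax_gt0 {R : realType} {c : nat} (u : 'cV[R]_c) j :
  0 < softmax u j 0.
Proof.
rewrite mxE divr_gt0 ?expR_gt0// (bigD1 j)//= ltr_pwDl ?expR_gt0//.
by rewrite sumr_ge0// => i _; exact: expR_ge0.
Qed.

Lemma sum_softmax {R : realType} {c : nat} (u : 'cV[R]_c.+1) :
  \sum_j softmax u j 0 = 1.
Proof.
under eq_bigr do rewrite mxE; rewrite -mulr_suml divff// gt_eqF//.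
by rewrite big_ord_recl ltr_pwDl ?expR_gt0// sumr_ge0// => i _; exact: expR_ge0.
Qed.

Lemma softmax_le1 {R : realType} {c : nat} (u : 'cV[R]_c.+1) j :
  softmax u j 0 <= 1.
Proof.
rewrite -(sum_softmax u) (bigD1 j)//= lerDl sumr_ge0// => i _.
exact/ltW/softmax_gt0.
Qed.

Lemma cross_entropy_ge0 {R : realType} {c : nat} (q : 'cV[R]_c) y :
  q y 0 <= 1 -> (0 <= cross_entropy q y)%E.
Proof. by move=> q1; rewrite oppe_ge0 lne_le0 lee_fin. Qed.

Lemma cross_entropy_softmax {R : realType} {c : nat} (u : 'cV[R]_c) j :
  cross_entropy (softmax u) j = (- ln (softmax u j 0))%:E.
Proof. by rewrite /cross_entropy lne_EFin ?softmax_gt0. Qed.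

Lemma measurable_lne_EFin {R : realType} :
  measurable_fun [set: R] (@lne R \o EFin).
Proof.
apply: measurable_fun_ifT => //.
- exact: measurable_fun_ler.
- by apply/measurable_EFinP; exact: measurable_ln.
Qed.

Lemma measurable_cross_entropy {R : realType} d (T : measurableType d)
    (D : set T) c (q : T -> 'cV[R]_c) (y : T -> 'I_c) :
  measurable_fun D (fun t => q t (y t) 0) ->
  measurable_fun D (fun t => cross_entropy (q t) (y t)).
Proof.
move=> mq; apply: measurableT_comp => //.
exact: (measurableT_comp measurable_lne_EFin).
Qed.

Lemma measurable_softmax {R : realType} d (T : measurableType d) (D : set T) c
    (u : T -> 'cV[R]_c.+1) : (forall j, measurable_fun D (fun t => u t j 0)) ->
  forall j, measurable_fun D (fun t => softmax (u t) j 0).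
Proof.
move=> mu j.
(* The quotient becomes the exponential of a difference, so measurability follows from that of
   [expR] and [ln], without inverses. *)
rewrite (_ : (fun t => _) =
    (fun t => expR (u t j 0 - ln (\sum_i expR (u t i 0))))).
  apply: measurableT_comp => //; apply: measurable_funB => //.
  apply: measurableT_comp; first exact: measurable_ln.
  by apply: measurable_sum => i; exact: measurableT_comp.
apply/funext => t; rewrite mxE expRB lnK// posrE big_ord_recl.
by rewrite ltr_pwDl ?expR_gt0// sumr_ge0// => i _; exact: expR_ge0.
Qed.

(** * Events of the sample space and the conditional law of the labels *)

Section sample_theory.
Context {R : realType} {d m c n : nat}.
Variable P : probability (sample R d m c n) R.

Lemma measurable_inputs : measurable_fun [set: sample R d m c n] inputs.
Proof. exact: (measurableT_comp measurable_fst measurable_fst). Qed.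

Lemma measurable_labels : measurable_fun [set: sample R d m c n] labels.
Proof. exact: (measurableT_comp measurable_snd measurable_fst). Qed.

Lemma measurable_concept : measurable_fun [set: sample R d m c n] concept.
Proof. exact: measurable_snd. Qed.

Lemma measurable_label_eq k j :
  measurable [set s : sample R d m c n | tnth (labels s) k = j].
Proof.
rewrite -[X in measurable X]setTI.
by apply: (measurableT_comp (measurable_tnth k) measurable_labels _
  (Y := [set j])).
Qed.

Lemma measurable_labels_eq Yb :
  measurable (labels @^-1` [set Yb] : set (sample R d m c n)).
Proof.
rewrite (_ : _ @^-1` _ = \bigcap_(k in setT)
    [set s : sample R d m c n | tnth (labels s) k = tnth Yb k]).
  by apply: fin_bigcap_measurable => // k _; exact: measurable_label_eq.
apply/seteqP; split=> s /= sY; first by move=> k _; rewrite /= sY.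
by apply/eq_from_tnth => k; exact: sY.
Qed.

Lemma measurable_concept_eq t :
  measurable (concept @^-1` [set t] : set (sample R d m c n)).
Proof. by rewrite -[X in measurable X]setTI; exact: measurable_concept. Qed.

(** Law of total probability: the fibres of [labels] form a finite measurable partition. *)
Lemma sum_labels (A : set (sample R d m c n)) : measurable A ->
  P A = (\sum_Yb P (A `&` labels @^-1` [set Yb]))%E.
Proof.
move=> mA; have mAY Yb : measurable (A `&` labels @^-1` [set Yb]).
  by apply: measurableI => //; exact: measurable_labels_eq.
rewrite {1}(_ : A = \bigcup_(Yb in setT) (A `&` labels @^-1` [set Yb])).
  rewrite measure_fin_bigcup//; [|exact: finite_finset|
    exact: trivIset_preimage1_in].
  rewrite (fsbigE (enum {: m.+1.-tuple 'I_c.+1})) ?enum_uniq//.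
    by rewrite big_enum_cond; apply: eq_bigl => Yb; rewrite in_setT.
  by move=> Yb _; rewrite mem_enum.
by apply/seteqP; split=> [s As|s [Yb _ []]//]; exists (labels s).
Qed.

Lemma fine_sum_labels (A : set (sample R d m c n)) : measurable A ->
  fine (P A) = \sum_Yb fine (P (A `&` labels @^-1` [set Yb])).
Proof.
move=> mA; rewrite sum_labels// -sum_fine// => Yb _.
rewrite fin_num_measure//; apply: measurableI => //.
exact: measurable_labels_eq.
Qed.

Lemma abduction_law_ge0 t Yb : 0 <= abduction_law P t Yb.
Proof. by rewrite divr_ge0// fine_ge0. Qed.

(** Positivity of p(t) matters: division by 0 yields 0, so for a null concept all weights would be
    0. *)
Lemma sum_abduction_law t : (0 < concept_prob P t)%E ->
  \sum_Yb abduction_law P t Yb = 1.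
Proof.
move=> t0; rewrite -mulr_suml.
under eq_bigr do rewrite setIC.
rewrite -fine_sum_labels ?divff//; last exact: measurable_concept_eq.
rewrite gt_eqF// fine_gt0// t0/= ltey_eq fin_num_measure//.
exact: measurable_concept_eq.
Qed.

(** Splitting the event by labelling and dividing by p(t) turns the marginal of the true label at
    [k] into a marginal of the abduction law. This ties the entries of [Qtilde] to the random
    selection. *)
Lemma label_concept_prob k j t : (0 < concept_prob P t)%E ->
  fine (P ([set s | tnth (labels s) k = j] `&` concept @^-1` [set t])) =
  fine (concept_prob P t) *
    \sum_(Yb : m.+1.-tuple 'I_c.+1 | tnth Yb k == j) abduction_law P t Yb.
Proof.
move=> t0; have mt := measurable_concept_eq t.
have pt0 : fine (concept_prob P t) != 0.
  by rewrite gt_eqF// fine_gt0// t0/= ltey_eq fin_num_measure.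
rewrite fine_sum_labels; last first.
  by apply: measurableI => //; exact: measurable_label_eq.
rewrite mulr_sumr [RHS]big_mkcond; apply: eq_bigr => Yb _.
case: ifPn => [/eqP Yk|/eqP Yk].
  rewrite /abduction_law mulrCA divff// mulr1; congr (fine (P _)).
  by apply/seteqP; split=> s /= [] => [[_ ->] ->//|sY ->]; rewrite sY.
rewrite (_ : _ `&` _ = set0) ?measure0//.
by apply/seteqP; split=> s //= [[sk _] sY]; apply: Yk; rewrite -sY.
Qed.

End sample_theory.

(** * Located samples and bounds on the matrix [Qtilde] *)

(** The second factor is finite and discrete, so a preimage is a finite union of rectangles, one per
    index. *)
Lemma measurable_fun_ord d d' (T : measurableType d) (T' : measurableType d')
    k (D : set T) (f : T * 'I_k.+1 -> T') :
  (forall i, measurable_fun D (fun t => f (t, i))) ->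
  measurable_fun (D `*` [set: 'I_k.+1]) f.
Proof.
(* Measurability of [D] is recovered from that of the product, as a preimage under the section at
   [ord0]. *)
move=> mf mDT Y mY; have mD : measurable D.
  have : measurable_fun [set: T] (fun t => (t, ord0 : 'I_k.+1)).
    exact: measurable_fun_pair.
  move=> /(_ measurableT _ mDT); rewrite setTI; congr measurable.
  by apply/seteqP; split => t //= [].
rewrite (_ : _ `&` _ = \bigcup_(i in [set: 'I_k.+1])
    ((D `&` (fun t => f (t, i)) @^-1` Y) `*` [set i])).
  apply: fin_bigcup_measurable => // i _; apply: measurableX => //.
  exact: mf.
apply/seteqP; split => [[t i] [[/= Dt _] Yt]|[t i] [j _ [[/= Dt Yt] ->]]] //.
by exists i.
Qed.

Section triplet_theory.
Context {R : realType} {d m c n : nat}.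
Variable P : probability (sample R d m c n) R.

Lemma measurable_tinput :
  measurable_fun [set: sample R d m c n * 'I_m.+1] tinput.
Proof.
rewrite -setXTT; apply: measurable_fun_ord => k.
exact: (measurableT_comp (measurable_tnth k) measurable_inputs).
Qed.

Lemma measurable_tlabel :
  measurable_fun [set: sample R d m c n * 'I_m.+1] tlabel.
Proof.
rewrite -setXTT; apply: measurable_fun_ord => k.
exact: (measurableT_comp (measurable_tnth k) measurable_labels).
Qed.

Lemma measurable_tsynth :
  measurable_fun [set: sample R d m c n * 'I_m.+1] tsynth.
Proof.
rewrite -setXTT; apply: measurable_fun_ord => k _ Y _.
exact: (measurable_concept measurableT (Y := [set t | Y (synthetic k t)])).
Qed.

Lemma located_law_le1 (A : set (sample R d m c n * 'I_m.+1)) :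
  (forall k, measurable [set s | A (s, k)]) -> (located_law P A <= 1)%E.
Proof.
move=> mA; rewrite /located_law.
apply: (@le_trans _ _ ((m.+1%:R^-1)%:E * \sum_(k < m.+1) 1)%E).
  rewrite lee_wpmul2l ?lee_fin//; apply: lee_sum => k _; exact: probability_le1.
by rewrite sumEFin -EFinM sumr_const card_ord mulVf.
Qed.

Lemma measurable_slice (A : set (sample R d m c n * 'I_m.+1)) k :
  measurable A -> measurable [set s | A (s, k)].
Proof.
move=> mA; rewrite -[X in measurable X]setTI.
have : measurable_fun [set: sample R d m c n] (fun s => (s, k)).
  exact: measurable_fun_pair.
exact.
Qed.

Lemma located_law_fin_num (A : set (sample R d m c n * 'I_m.+1)) :
  measurable A -> located_law P A \is a fin_num.
Proof.
move=> mA; rewrite ge0_fin_numE ?measure_ge0// (le_lt_trans _ (ltry 1))//.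
by apply: located_law_le1 => k; exact: measurable_slice.
Qed.

Lemma measurable_tlabel_eq j :
  measurable (tlabel @^-1` [set j] : set (sample R d m c n * 'I_m.+1)).
Proof. by rewrite -[X in measurable X]setTI; exact: measurable_tlabel. Qed.

Lemma measurable_tsynth_eq o :
  measurable (tsynth @^-1` [set o] : set (sample R d m c n * 'I_m.+1)).
Proof. by rewrite -[X in measurable X]setTI; exact: measurable_tsynth. Qed.

Lemma Qtilde_le1 j o : Qtilde P j o <= 1.
Proof.
have mj := measurable_tlabel_eq j; have mo := measurable_tsynth_eq o.
rewrite mxE; set x := fine _; set y := fine _.
have xy : x <= y.
  rewrite fine_le ?located_law_fin_num//; first exact: measurableI.
  by apply: le_measure => //; rewrite inE//; exact: measurableI.
have : 0 <= y by rewrite fine_ge0// measure_ge0.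
(* If p(y = j) = 0, the inverse of 0 is 0 and the entry is 0. *)
rewrite le_eqVlt => /predU1P[<-|y0]; first by rewrite invr0 mulr0.
by rewrite ler_pdivrMr// mul1r.
Qed.

Lemma Qtilde_synthetic_ge j k t : (0 < concept_prob P t)%E ->
  fine (concept_prob P t) / m.+1%:R *
    \sum_(Yb : m.+1.-tuple 'I_c.+1 | tnth Yb k == j) abduction_law P t Yb
  <= Qtilde P j (synthetic k t).
Proof.
move=> t0; have mj := measurable_tlabel_eq j.
have mo := measurable_tsynth_eq (synthetic k t).
have mA k' : measurable ([set s : sample R d m c n | tnth (labels s) k' = j] `&`
    concept @^-1` [set t]).
  apply: measurableI; first exact: measurable_label_eq.
  exact: measurable_concept_eq.
rewrite mulrAC -label_concept_prob// mxE; set x := fine _ / _.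
set y := fine (located_law _ _); set z := fine (located_law _ _).
have xy : x <= y.
  rewrite /x -[_^-1]/(fine (m.+1%:R^-1)%:E) -fineM ?fin_num_measure//.
  apply: fine_le; [by rewrite fin_numM// fin_num_measure| |].
    by rewrite located_law_fin_num//; exact: measurableI.
  (* Only the term of location [k] is kept from the average over locations; the others are
     nonnegative. *)
  rewrite muleC lee_wpmul2l ?lee_fin// (bigD1 k)//=.
  rewrite (@le_trans _ _ (P [set s | (tsynth @^-1` [set synthetic k t] `&`
      tlabel @^-1` [set j]) (s, k)]))//; last by rewrite leeDl// sume_ge0.
  apply: le_measure; rewrite ?inE//.
    by apply: measurable_slice; exact: measurableI.
  by move=> s /= [sj st]; split => //=; rewrite /tsynth/= st.
have zx : y <= z.
  rewrite fine_le ?located_law_fin_num//; first exact: measurableI.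
  by apply: le_measure => //; rewrite inE//; exact: measurableI.
have z1 : z <= 1.
  rewrite -[1]/(fine 1%E) fine_le ?located_law_fin_num//.
  by apply: located_law_le1 => k'; exact: measurable_slice.
have : 0 <= z by rewrite fine_ge0// measure_ge0.
(* A null label makes the entry 0 by convention, but then [x <= y <= z] forces the lower bound down
   to 0 too. Otherwise [z <= 1] gives [x * z <= x <= y]. *)
rewrite le_eqVlt => /predU1P[z0|z0].
  by rewrite -z0 invr0 mulr0 (le_trans xy)// (le_trans zx)// -z0.
rewrite ler_pdivlMr// (le_trans _ xy)// ler_piMr// /x divr_ge0// fine_ge0//.
Qed.

End triplet_theory.

(** * Integration over a uniform location and the pointwise bound on the TL loss *)

Section risk_integrals.
Context {R : realType} {d m c n : nat}.
Variable P : probability (sample R d m c n) R.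
Variable h : d.-tuple R -> 'cV[R]_c.+1.

(** The located law is a scaled finite sum of the images of [P] under the sections at each location,
    and the integral follows this decomposition. *)
Lemma ge0_integral_located_law (D : set (sample R d m c n * 'I_m.+1))
    (f : sample R d m c n * 'I_m.+1 -> \bar R) :
  measurable D -> measurable_fun D f -> (forall z, D z -> 0 <= f z)%E ->
  (\int[located_law P]_(z in D) f z =
   (m.+1%:R^-1)%:E *
   \sum_(k < m.+1) \int[P]_(s in [set s | D (s, k)]) f (s, k))%E.
Proof.
move=> mD mf f0.
(* [msum] takes a family of measures indexed by [nat]; [inord] extends the locations to such a
   family, and only indices below [m.+1] are summed. *)
have mphi (i : nat) : measurable_fun [set: sample R d m c n]
    (fun s => (s, inord i : 'I_m.+1)) by exact: measurable_fun_pair.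
pose mk (i : nat) : {measure set (sample R d m c n * 'I_m.+1) -> \bar R} :=
  measure_function_pushforward__canonical__measure_function_Measure P (mphi i).
have m0 : 0 <= m.+1%:R^-1 :> R by rewrite invr_ge0.
rewrite (eq_measure_integral (mscale (NngNum m0) (msum mk m.+1))); last first.
  move=> A mA _; rewrite /located_law /mscale/= /msum; congr (_ * _)%E.
  by apply: eq_bigr => k _; rewrite /mk/= /pushforward inord_val.
rewrite ge0_integral_mscale// ge0_integral_measure_sum//; congr (_ * _)%E.
apply: eq_bigr => k _; rewrite /mk/= ge0_integral_pushforward//.
  by rewrite /comp /= inord_val.
by move=> z; rewrite inE; exact: f0.
Qed.

Lemma qtildeE x o :
  qtilde P h x o 0 = \sum_j Qtilde P j o * softmax (h x) j 0.
Proof. by rewrite mxE; apply: eq_bigr => j _; rewrite mxE. Qed.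

(** A softmax average of entries at most 1. It makes the TL loss nonnegative, as the integral
    manipulations below require. *)
Lemma qtilde_le1 x o : qtilde P h x o 0 <= 1.
Proof.
rewrite qtildeE -(sum_softmax (h x)); apply: ler_sum => j _.
by rewrite ler_piMl ?Qtilde_le1// ltW// softmax_gt0.
Qed.

Lemma qtilde_synthetic_ge x k t (b : R) : 0 < b ->
  (b%:E <= concept_prob P t)%E ->
  b / m.+1%:R * (\sum_Yb abduction_law P t Yb * softmax (h x) (tnth Yb k) 0)
  <= qtilde P h x (synthetic k t) 0.
Proof.
move=> b0 bt.
have t0 : (0 < concept_prob P t)%E by rewrite (lt_le_trans _ bt).
(* Labellings are grouped by their label at [k], so that both sides become sums over classes and the
   entrywise bound on [Qtilde] applies. *)
rewrite qtildeE (partition_big (fun Yb => tnth Yb k) xpredT)//= mulr_sumr.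
apply: ler_sum => j _.
rewrite (eq_bigr (fun Yb => abduction_law P t Yb * softmax (h x) j 0));
  last first.
  by move=> Yb /eqP ->.
rewrite -mulr_suml mulrA ler_pM2r ?softmax_gt0//.
apply: le_trans (Qtilde_synthetic_ge j k t0).
rewrite ler_wpM2r ?sumr_ge0//; first by move=> Yb _; exact: abduction_law_ge0.
rewrite ler_pM2r ?invr_gt0// -lee_fin fineK// fin_num_measure//.
exact: measurable_concept_eq.
Qed.

(** The pointwise form of the theorem, for one input, location and concept; only averaging and
    integration remain after it. *)
Lemma cross_entropy_qtilde_le x k t (b : R) : 0 < b ->
  (b%:E <= concept_prob P t)%E ->
  (cross_entropy (qtilde P h x) (synthetic k t) <=
   (\sum_Yb abduction_law P t Yb * - ln (softmax (h x) (tnth Yb k) 0)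
    + (ln m.+1%:R - ln b))%:E)%E.
Proof.
move=> b0 bt.
have t0 : (0 < concept_prob P t)%E by rewrite (lt_le_trans _ bt).
have sel0 := abduction_law_ge0 P t; have sel1 := sum_abduction_law t0.
have g0 (Yb : m.+1.-tuple 'I_c.+1) := softmax_gt0 (h x) (tnth Yb k).
have G0 := weighted_sum_gt0 sel0 sel1 g0.
have bm0 : 0 < b / m.+1%:R by rewrite divr_gt0.
have bq := qtilde_synthetic_ge x k b0 bt.
(* Positivity of the entry rules out an infinite loss and allows real logarithms. *)
have q0 := lt_le_trans (mulr_gt0 bm0 G0) bq.
rewrite /cross_entropy lne_EFin// -EFinN lee_fin.
under eq_bigr do rewrite mulrN.
rewrite sumrN lerNl opprD opprK opprB.
rewrite -ler_ln ?posrE ?mulr_gt0// in bq; apply: le_trans bq.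
rewrite lnM ?posrE// ln_div ?posrE// addrC.
by rewrite lerD2l sum_mul_ln_le.
Qed.

End risk_integrals.

(** * Both risks as integrals over samples, and their comparison *)

Section risk_bounds.
Context {R : realType} {d m c n : nat}.
Variable P : probability (sample R d m c n) R.
Variables (X : set (d.-tuple R)) (h : d.-tuple R -> 'cV[R]_c.+1).
Hypothesis mX : measurable X.
Hypothesis PX : {ae P, forall s, forall k, X (tnth (inputs s) k)}.
Hypothesis mh : forall j, measurable_fun X (fun x => h x j 0).

(** The NeSy integral pulls back to [D], whereas the TL integral at location [k] pulls back to the
    larger [E k]. By [PX] the difference is null, so [D] serves for both. *)
Let D := [set s : sample R d m c n | forall k, X (tnth (inputs s) k)].

Let E k := [set s : sample R d m c n | X (tnth (inputs s) k)].

Let mE k : measurable (E k).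
Proof.
rewrite -[E k]setTI.
exact: (measurableT_comp (measurable_tnth k) measurable_inputs).
Qed.

Let mD : measurable D.
Proof.
rewrite (_ : D = \bigcap_(k in setT) E k); first exact: fin_bigcap_measurable.
by apply/seteqP; split=> s Ds k; [move=> _|]; exact: Ds.
Qed.

Let PDC : P (~` D) = 0%E.
Proof. by apply/negligibleP => //; exact: measurableC. Qed.

Let PD : P D = 1%E.
Proof.
by rewrite -[D]setCK probability_setC ?PDC ?sube0//; exact: measurableC.
Qed.

Let G (z : d.-tuple R * 'I_(m.+1 * n.+1)) := cross_entropy (qtilde P h z.1) z.2.

Let G0 z : (0 <= G z)%E.
Proof. by rewrite cross_entropy_ge0// qtilde_le1. Qed.

Let mG : measurable_fun (X `*` setT) G.
Proof.
apply: measurable_fun_ord => o.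
apply: measurable_cross_entropy; under eq_fun do rewrite qtildeE.
apply: measurable_sum => j; apply: measurable_funM.
  exact: (measurable_cst (Qtilde P j o)).
exact: (measurable_softmax (u := h)).
Qed.

Let phi (z : sample R d m c n * 'I_m.+1) := (tinput z, tsynth z).

Let mphi : measurable_fun [set: sample R d m c n * 'I_m.+1] phi.
Proof.
apply: measurable_fun_pair; first exact: measurable_tinput.
exact: measurable_tsynth.
Qed.

Let mphiX : measurable (phi @^-1` (X `*` setT)).
Proof.
by rewrite -[X in measurable X]setTI; apply: mphi => //; exact: measurableX.
Qed.

Let mGphi : measurable_fun (phi @^-1` (X `*` setT)) (G \o phi).
Proof.
apply: measurable_comp mG (measurable_funTS mphi); first exact: measurableX.
exact: image_preimage_subset.
Qed.

(** This is [G \o phi] on the section at location [k]; its measurability and sign come from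
    there. *)
Let F k (s : sample R d m c n) :=
  cross_entropy (qtilde P h (tnth (inputs s) k)) (synthetic k (concept s)).

Let mF k : measurable_fun (E k) (F k).
Proof.
apply: (measurable_comp (F := phi @^-1` (X `*` setT)) (f := G \o phi)
  (g := fun s => (s, k))) => //.
  by move=> _ [s Xs <-].
by apply: measurable_funTS; exact: measurable_fun_pair.
Qed.

Let mFD k : measurable_fun D (F k).
Proof. by refine (measurable_funS (@mE k) _ (@mF k)) => s; exact. Qed.

(** Pulling back along [phi] and splitting by location gives integrals over the sets [E k], which
    are then brought to the common domain [D] and summed. *)
Lemma tl_riskE : tl_risk P X h =
  (\int[P]_(s in D) ((m.+1%:R^-1)%:E * \sum_(k < m.+1) F k s))%E.
Proof.
rewrite (_ : tl_risk P X h =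
    \int[pushforward (located_law P) phi]_(z in X `*` setT) G z)%E//.
rewrite (ge0_integral_pushforward mphi)//; last first.
  exact: measurableX.
rewrite ge0_integral_located_law//; last by move=> z _; exact: G0.
rewrite [RHS]ge0_integralZl//; last 2 first.
- by apply: emeasurable_sum => k; exact: mFD.
- by move=> s _; apply: sume_ge0 => k _; exact: (G0 (phi (s, k))).
rewrite ge0_integral_sum//; last by move=> k s _; exact: (G0 (phi (s, k))).
congr (_ * _)%E; apply: eq_bigr => k _.
rewrite (_ : [set s | _] = E k); last by apply/seteqP; split => s //= [].
(* Removing the null complement of [D] leaves exactly [D], which is contained in [E k]. *)
rewrite (ge0_negligible_integral _ _ (@mF k) _ PDC)//; last 2 first.
  exact: measurableC.
  by move=> s _; exact: (G0 (phi (s, k))).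
by rewrite setDE setCK setIidr// => s; exact.
Qed.

Variable (S : 'I_n.+1 -> {set m.+1.-tuple 'I_c.+1}).
Hypothesis PS : {ae P, forall s, labels s \in S (concept s)}.

(** The true labels are almost surely candidates, so the numerator is the probability of a null
    event. Sums over candidates thus extend to all labellings. *)
Lemma abduction_law_notin t Yb : Yb \notin S t -> abduction_law P t Yb = 0.
Proof.
move=> YbS; rewrite /abduction_law (_ : P _ = 0%E) ?mul0r//.
apply/negligibleP.
  apply: measurableI; first exact: measurable_labels_eq.
  exact: measurable_concept_eq.
by apply: negligibleS PS => s /= [sY st]; rewrite sY st; apply/negP.
Qed.

(** The NeSy integrand in real form, with locations outside and all labellings inside, to match the
    bound of [cross_entropy_qtilde_le] term by term. *)
Let N (z : m.+1.-tuple (d.-tuple R) * 'I_n.+1) : R :=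
  m.+1%:R^-1 * \sum_(k < m.+1) \sum_Yb abduction_law P z.2 Yb *
    - ln (softmax (h (tnth z.1 k)) (tnth Yb k) 0).

Let N0 z : 0 <= N z.
Proof.
rewrite mulr_ge0// sumr_ge0// => k _; rewrite sumr_ge0// => Yb _.
by rewrite mulr_ge0 ?abduction_law_ge0// oppr_ge0 ln_le0// softmax_le1.
Qed.

Let V := [set v : m.+1.-tuple (d.-tuple R) | forall k, X (tnth v k)].

Let mV : measurable V.
Proof.
rewrite (_ : V = \bigcap_(k in setT) ((fun v => tnth v k) @^-1` X)).
  apply: fin_bigcap_measurable => // k _; rewrite -[X in measurable X]setTI.
  exact: (measurable_tnth k measurableT mX).
by apply/seteqP; split=> s Ds k; [move=> _|]; exact: Ds.
Qed.

Let mVT : measurable (V `*` [set: 'I_n.+1]).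
Proof. exact: measurableX. Qed.

Let mN : measurable_fun (V `*` setT) (EFin \o N).
Proof.
apply: measurable_fun_ord => t; apply/measurable_EFinP.
apply: measurable_funM => //; apply: measurable_sum => k.
apply: measurable_sum => Yb; apply: measurable_funM.
  exact: (measurable_cst (abduction_law P t Yb)).
apply: measurableT_comp => //.
apply: measurableT_comp; first exact: measurable_ln.
apply: (measurable_softmax (u := fun v => h (tnth v k))) => j.
apply: (measurable_comp mX _ (mh j)); first by move=> _ [v Dv <-]; exact: Dv.
by apply: measurable_funTS; exact: (measurable_tnth k).
Qed.

Let psi (s : sample R d m c n) := (inputs s, concept s).

Let mpsi : measurable_fun [set: sample R d m c n] psi.
Proof.
apply: measurable_fun_pair; first exact: measurable_inputs.
exact: measurable_concept.
Qed.

Let mNpsi : measurable_fun D (EFin \o N \o psi).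
Proof.
apply: measurable_comp mVT _ mN (measurable_funTS mpsi).
by move=> _ [s Ds <-].
Qed.

Lemma nesy_riskE :
  nesy_risk P X h S (abduction_law P) = (\int[P]_(s in D) (N (psi s))%:E)%E.
Proof.
rewrite /nesy_risk [X in integral _ X _](_ : _ = V `*` setT); last first.
  by apply/seteqP; split => z //= [].
transitivity (\int[pushforward P psi]_(z in V `*` setT) (N z)%:E)%E.
  congr (integral _ _ _); apply/funext => z; rewrite big_mkcond/= /N.
  rewrite exchange_big/= mulr_sumr -sumEFin; apply: eq_bigr => Yb _.
  (* Labellings outside [S] have weight 0 and contribute to neither side. *)
  case: ifPn => YbS; last first.
    by rewrite big1 ?mulr0// => k _; rewrite abduction_law_notin// mul0r.
  rewrite -mulr_sumr [in RHS]mulrCA [RHS]EFinM; congr (_ * _)%E.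
  rewrite [RHS]EFinM; congr (_ * _)%E; rewrite -sumEFin.
  by apply: eq_bigr => k _; rewrite cross_entropy_softmax.
rewrite (ge0_integral_pushforward mpsi)//; last by move=> z _; rewrite lee_fin.
by congr integral; apply/seteqP; split => s //= [].
Qed.

(** Serves the case of an infinite constant, where the risk must differ from -oo. *)
Lemma nesy_risk_ge0 : (0 <= nesy_risk P X h S (abduction_law P))%E.
Proof. by rewrite nesy_riskE integral_ge0// => s _; rewrite lee_fin. Qed.

Lemma tl_risk_le_nesy_risk (b : R) : 0 < b ->
  (forall t, b%:E <= concept_prob P t)%E ->
  (tl_risk P X h <=
   nesy_risk P X h S (abduction_law P) + (ln m.+1%:R - ln b)%:E)%E.
Proof.
move=> b0 bP; set C := ln _ - _.
have b1 : b <= 1.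
  rewrite -lee_fin (le_trans (bP ord0))// probability_le1//.
  exact: measurable_concept_eq.
(* [b <= 1 <= m.+1] makes the constant nonnegative, so additivity of nonnegative integrals applies;
   as [D] has probability 1, the constant is its own integral over [D]. *)
have C0 : 0 <= C by rewrite subr_ge0 (le_trans (ln_le0 b1))// ln_ge0// ler1n.
rewrite tl_riskE nesy_riskE.
have -> : (C%:E = \int[P]_(s in D) cst C%:E s)%E.
  by transitivity (C%:E * P D)%E; [rewrite PD mule1|rewrite integral_cst].
rewrite -ge0_integralD//; last by move=> s _; rewrite lee_fin.
apply: ge0_le_integral => //.
- move=> s _; rewrite mule_ge0// ?lee_fin// sume_ge0// => k _.
  exact: (G0 (phi (s, k))).
- by apply: measurable_funeM; apply: emeasurable_sum => k; exact: mFD.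
- exact: emeasurable_funD.
(* The constant is spread as an average over the locations, which reduces the comparison to one
   location at a time. *)
move=> s _; have mC : C = m.+1%:R^-1 * \sum_(k < m.+1) C.
  by rewrite sumr_const card_ord -[C *+ _]mulr_natl mulKf.
rewrite -EFinD {1}mC -mulrDr -big_split/= EFinM lee_wpmul2l ?lee_fin//.
rewrite -sumEFin; apply: lee_sum => k _.
exact: cross_entropy_qtilde_le.
Qed.

End risk_bounds.

Theorem theorem2 (R : realType) (d m c n : nat)
    (P : probability (sample R d m c n) R)
    (X : set (d.-tuple R)) (mX : measurable X)
    (L : signature) (B : set (formula L))
    (fact : 'I_m.+1 -> 'I_c.+1 -> formula L) (target : 'I_n.+1 -> formula L)
    (PX : {ae P, forall s, forall k, X (tnth (inputs s) k)})
    (PS : {ae P, forall s,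
             labels s \in candidates B fact target (concept s)})
    (h : d.-tuple R -> 'cV[R]_c.+1)
    (mh : forall j, measurable_fun X (fun x => h x j 0)) :
  (tl_risk P X h <=
   nesy_risk P X h (candidates B fact target) (abduction_law P)
   + ((ln m.+1%:R)%:E - lne (min_concept_prob P)))%E.
Proof.
have bP t : (min_concept_prob P <= concept_prob P t)%E by exact: bigmin_le.
(* A minimum of 0 gives [lne] the value -oo, so the right-hand side is +oo. *)
have [b0|b0] := leP (min_concept_prob P) 0%E.
  have nesy0 := nesy_risk_ge0 mX mh PS.
  by rewrite le0_lneNy//= addey ?leey// gt_eqF// (lt_le_trans (ltNyr 0)).
(* This excludes the value +oo, the default of the minimum, and leaves a positive real [b]. *)
have : (min_concept_prob P <= 1)%E.
  rewrite (le_trans (bP ord0))// probability_le1//.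
  exact: measurable_concept_eq.
case: (min_concept_prob P) b0 bP => [b| |]//; rewrite lte_fin => b0 bP _.
rewrite lne_EFin// -EFinB; exact: tl_risk_le_nesy_risk.
Qed.
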